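(* Let $1/2<c\le 1$. There exist a constant $K=K(c)>0$ and $n_0=n_0(c)$ such that for every $n\ge n_0$ the following holds. If $G$ is a graph on $n$ vertices with minimum degree $\delta(G)\ge cn$, then for every proper edge-colouring $\chi$ of $G$, the graph $G$ contains a Hamilton cycle whose edges receive at least $cn-K\sqrt{n}$ distinct colours under $\chi$.
   Context: A proper edge-colouring of a graph assigns colours to edges so that any two edges sharing a vertex receive different colours. The number of distinct colours of a subgraph is $|\{\chi(e): e\in E(H)\}|$. (The paper states the bound as $cn-O(\sqrt n)$, with the implicit constant depending only on $c$.) *)

(* Defs.v *)
From HB Require Import structures.
From mathcomp Require Import all_boot all_order all_algebra.
From mathcomp Require Import reals.
Set Implicit Arguments.
Unset Strict Implicit.
Unset Printing Implicit Defensive.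

Record sgraph := SGraph {
  vertex :> finType;
  adj : rel vertex;
  adj_sym : symmetric adj;
  adj_irrefl : irreflexive adj
}.

Definition edges (G : sgraph) : {set {set G}} :=
  [set [set x; y] | x in G, y in G & adj x y].

Definition degree (G : sgraph) (v : G) : nat := #|[set w | adj v w]|.

(* The default value #|G| exceeds every degree, so it is only attained
   by the graph without vertices. *)
Definition min_degree (G : sgraph) : nat :=
  \big[minn/#|G|]_(v : G) degree v.

(* A colouring is a function on all vertex sets, of which only the values on
   edges matter. *)
Definition proper_edge_colouring (G : sgraph) (C : eqType)
    (chi : {set G} -> C) : Prop :=
  forall e f : {set G}, e \in edges G -> f \in edges G ->
    e != f -> e :&: f != set0 -> chi e != chi f.

Definition num_colours (G : sgraph) (C : eqType) (chi : {set G} -> C)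
    (F : {set {set G}}) : nat :=
  size (undup [seq chi e | e <- enum F]).

(* The cyclic sequence p lists the vertices in order; without the bound on its
   size, a single edge traversed back and forth would count as a cycle. *)
Definition hamilton_cycle (G : sgraph) (p : seq G) : Prop :=
  [/\ 2 < size p, ucycle (@adj G) p & forall v : G, v \in p].

Definition cycle_edges (G : sgraph) (p : seq G) : {set {set G}} :=
  [set [set x; next p x] | x in p].

(* Main.v *)
Require Import Defs.
From mathcomp Require Import all_boot all_order all_algebra.
From mathcomp Require Import reals.
From mathcomp Require Import zify lra.
Set Implicit Arguments.
Unset Strict Implicit.
Unset Printing Implicit Defensive.
Import Order.TTheory GRing.Theory Num.Theory.

(* Cover G by t ~ sqrt n oriented paths with starts X, and let T be a set of
   vertices outside X whose incoming path edges form a rainbow set.  For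
   distinct x_i in X and distinct y_i outside X, deleting the edge entering each
   y_i and adding x_i y_i again gives t paths: the cut pieces are matched up at
   their starts, so no cycle can arise.  As in Woolbright's argument for Latin
   transversals, process the starts one at a time: x_i may use the colours
   missing from T together with those freed earlier, so if no switch gains a
   colour then each start frees at least d - |T| - t further vertices of T,
   where d is the minimum degree.  Hence t (d - |T| - t) <= |T| < t ^ 2 for a
   maximal T, that is, |T| >= d - 2 t.  Finally the t paths, put in cyclic order,
   have at most t consecutive non-adjacent pairs, and since d > n / 2 each of
   these can be removed by a 2-opt exchange that loses one edge. *)

(** * Consecutive entries of a sequence and the edges of a cyclic order *)

Definition linked (T : eqType) (u v : T) (s : seq T) := infix [:: u; v] s.

Lemma linkedP (T : eqType) (u v : T) (s : seq T) :
  reflect (exists s1 s2, s = s1 ++ u :: v :: s2) (linked u v s).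
Proof.
apply: (iffP idP).
  by move=> /infixP[s1 [s2 ->]]; exists s1, s2.
by case=> s1 [s2 ->]; apply/infixP; exists s1, s2.
Qed.

Lemma linked_rev (T : eqType) (u v : T) (s : seq T) :
  linked u v (rev s) = linked v u s.
Proof. exact: (infix_rev [:: v; u]). Qed.

Lemma linked_catl (T : eqType) (u v : T) (a b : seq T) :
  linked u v a -> linked u v (a ++ b).
Proof. exact: infix_catr. Qed.

Lemma linked_catr (T : eqType) (u v : T) (a b : seq T) :
  linked u v b -> linked u v (a ++ b).
Proof. exact: infix_catl. Qed.

Lemma linked_catE (T : eqType) (u v : T) (a b : seq T) : linked u v (a ++ b) ->
  [\/ linked u v a, linked u v b | exists a' b', a = rcons a' u /\ b = v :: b'].
Proof.
elim: a => [|x a IHa]; first by constructor 2.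
rewrite /linked cat_cons infix_consl; case/orP=> [|/IHa []].
- case: a {IHa} => [|y a] /=.
    case: b => [|y b]; rewrite ?andbF //= => /and3P[/eqP-> /eqP-> _].
    by constructor 3; exists [::], b.
  by case/and3P=> /eqP-> /eqP-> _; constructor 1; rewrite /= !eqxx prefix0s.
- by move=> h; constructor 1; rewrite infix_consl [infix _ _]h orbT.
- by move=> h; constructor 2.
- by case=> a' [b' [-> ->]]; constructor 3; exists (x :: a'), b'.
Qed.

Lemma linked_mem (T : eqType) (u v : T) (s : seq T) :
  linked u v s -> u \in s /\ v \in s.
Proof. by case/linkedP=> s1 [s2 ->]; rewrite !mem_cat !inE !eqxx !orbT. Qed.

Lemma linked_next (T : eqType) (u v : T) (s : seq T) :
  uniq s -> linked u v s -> next s u = v.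
Proof.
move=> Us /linkedP[s1 [s2 def_s]].
by rewrite -(next_rot (size s1) Us) def_s rot_size_cat /= eqxx.
Qed.

Lemma next_last (T : eqType) (x : T) (s : seq T) :
  uniq (x :: s) -> next (x :: s) (last x s) = x.
Proof.
move=> Us; rewrite -(next_rot (size (belast x s)) Us).
rewrite {1}lastI -cats1 rot_size_cat /=.
by case: s {Us} => [|y s] /=; rewrite eqxx.
Qed.

(** Separates the wrap-around pair from the linked ones, so that exchanges on a cyclic order can be
    analysed on plain sequences. *)
Lemma cycle_edges_cons (G : sgraph) (x : G) (s : seq G) (e : {set G}) :
  uniq (x :: s) ->
  e \in cycle_edges (x :: s) <->
  e = [set last x s; x] \/ exists u v, linked u v (x :: s) /\ e = [set u; v].
Proof.
move=> Us; split=> [/imsetP[u u_in ->]|].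
  have [s1 [s2 def_s]] : exists s1 s2, x :: s = s1 ++ u :: s2.
    by case/splitPr: u_in => s1 s2; exists s1, s2.
  case: s2 def_s => [|v s2] def_s.
    left; have -> : u = last x s by rewrite -(last_cons x) def_s last_cat.
    by rewrite next_last.
  have uv : linked u v (x :: s) by apply/linkedP; exists s1, s2.
  by right; exists u, v; rewrite (linked_next Us uv).
case=> [->|[u [v [uv ->]]]]; apply/imsetP.
  by exists (last x s); rewrite ?mem_last ?next_last.
by exists u; [case: (linked_mem uv)|rewrite (linked_next Us uv)].
Qed.

Lemma cycle_edges_rot (G : sgraph) (i : nat) (p : seq G) :
  uniq p -> cycle_edges (rot i p) = cycle_edges p.
Proof.
move=> Up; apply/setP=> e; apply/imsetP/imsetP=> -[u].
  by rewrite mem_rot => u_in ->; exists u; rewrite ?next_rot.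
by move=> u_in ->; exists u; rewrite ?mem_rot ?next_rot.
Qed.

Lemma mem_edges (G : sgraph) (u v : G) : ([set u; v] \in edges G) = adj u v.
Proof.
apply/imset2P/idP=> [[x y _]|uv]; last by exists u v; rewrite ?inE.
rewrite inE => /andP[_ xy] /setP E.
have := E u; have := E v; have := E x; have := E y; rewrite !inE !eqxx !orbT /=.
by do 2!case/orP=> /eqP ?; do 2!case/esym/orP=> /eqP ?; subst; rewrite // adj_sym.
Qed.

(** * 2-opt exchanges, and closing an order into a Hamilton cycle *)

Lemma uniq_flip (T : eqType) (a b : seq T) :
  uniq (a ++ rev b) = uniq (a ++ b).
Proof. by apply: perm_uniq; rewrite perm_cat2l perm_rev. Qed.

(** Reversing the block [y :: b] alters only two cyclic pairs: [last x a, y] and [last y b, x]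
    become [last x a, last y b] and [y, x]. Both new pairs are edges and the second old pair is not,
    so at most one edge is lost and one non-edge disappears. *)
Lemma cycle_edges_flip (G : sgraph) (x y : G) (a b : seq G) :
  uniq ((x :: a) ++ y :: b) -> adj (last x a) (last y b) -> adj x y ->
  ~~ adj (last y b) x ->
  cycle_edges ((x :: a) ++ y :: b) :&: edges G
    \subset [set last x a; y] |: cycle_edges ((x :: a) ++ rev (y :: b)) /\
  cycle_edges ((x :: a) ++ rev (y :: b)) :\: edges G
    \subset (cycle_edges ((x :: a) ++ y :: b) :\: edges G)
             :\ [set last y b; x].
Proof.
move=> U uz xy zx.
have U' : uniq ((x :: a) ++ rev (y :: b)).
  by rewrite uniq_flip.
have last_q : last x (a ++ y :: b) = last y b by rewrite last_cat.
have last_q' : last x (a ++ rev (y :: b)) = y.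
  by rewrite last_cat rev_cons last_rcons.
split; apply/subsetP=> e; rewrite !inE => /andP[].
  rewrite cat_cons in U U' *; move/(cycle_edges_cons _ U); rewrite last_q.
  case=> [->|[u [v [+ ->]]]]; first by rewrite mem_edges (negPf zx).
  rewrite -cat_cons => /linked_catE[uv|uv|[a' [b' [def_a [<- _]]]]] _.
  - apply/orP; right; apply/(cycle_edges_cons _ U'); right; exists u, v.
    by rewrite -cat_cons linked_catl.
  - apply/orP; right; apply/(cycle_edges_cons _ U'); right; exists v, u.
    by rewrite -cat_cons setUC; split=> //; apply: linked_catr; rewrite linked_rev.
  - by rewrite -(last_cons x) def_a last_rcons eqxx.
move=> e_bad; rewrite cat_cons in U U' *.
move/(cycle_edges_cons _ U'); rewrite last_q' => -[def_e|[u [v [uv def_e]]]].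
  by move: e_bad; rewrite def_e mem_edges adj_sym xy.
rewrite e_bad /=.
have {}uv : linked u v (x :: a) \/ linked v u (y :: b).
  move: uv; rewrite -cat_cons => /linked_catE[|| [a' [b' [def_a def_b]]]].
  - by left.
  - by rewrite linked_rev; right.
  case/negP: e_bad; rewrite def_e mem_edges.
  have <- : last x a = u by rewrite -(last_cons x) def_a last_rcons.
  suff <- : last y b = v by [].
  by move: def_b; rewrite lastI rev_rcons => -[].
(* The surviving pair lies inside one block, whereas [last y b] and [x] lie in different blocks. *)
have no_cross t : t \in x :: a -> t \in y :: b -> False.
  move: U; rewrite -cat_cons cat_uniq => /and3P[_ /hasPn h _] ta tb.
  by move: (h _ tb); rewrite /= ta.
apply/andP; split.
  apply/eqP=> E; have := set21 (last y b) x; have := set22 (last y b) x.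
  rewrite -E def_e; case: uv => /linked_mem[m1 m2].
    move=> _; rewrite !inE => /orP[]/eqP Ez; apply: no_cross (mem_last y b).
      by rewrite Ez.
    by rewrite Ez.
  move=> + _; rewrite !inE => /orP[]/eqP Ex; apply: no_cross (mem_head x a) _.
    by rewrite Ex.
  by rewrite Ex.
apply/(cycle_edges_cons _ U); right; rewrite def_e -cat_cons.
case: uv => uv; first by exists u, v; rewrite linked_catl.
by exists v, u; rewrite setUC linked_catr.
Qed.

(** Dirac's counting: the neighbours of [x] and the successors of the neighbours of [last x s] are
    together more than [#|G|] many, so they meet, and the common vertex tells where to reverse. *)
Lemma two_opt (G : sgraph) (x : G) (s : seq G) :
  (forall v : G, #|G| < 2 * degree v) ->
  uniq (x :: s) -> (forall v, v \in x :: s) -> ~~ adj (last x s) x ->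
  exists q e,
    [/\ uniq q, forall v, v \in q,
        cycle_edges (x :: s) :&: edges G \subset e |: cycle_edges q &
        cycle_edges q :\: edges G \subset
        (cycle_edges (x :: s) :\: edges G) :\ [set last x s; x]].
Proof.
move=> deg Us all_s zx; set z := last x s.
have [u zu xu] : exists2 u, adj z u & adj x (next (x :: s) u).
  apply/exists_inP; apply: contraT; rewrite negb_exists_in => /forall_inP none.
  have inj : injective (next (x :: s)) by apply: (can_inj (prev_next Us)).
  have : #|[set w | adj x w] :|: next (x :: s) @: [set w | adj z w]| <= #|G|.
    exact: max_card.
  rewrite cardsU (card_imset _ inj) (_ : _ :&: _ = set0) ?cards0 ?subn0.
    have := deg x; have := deg z; rewrite /degree => dz dx dd.
    have := leq_add dx dz; rewrite !mul2n -!addnn; lia.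
  apply/setP=> w; rewrite !inE; apply/negP=> /andP[xw /imsetP[u]].
  by rewrite inE => /none /negP nxu def_w; apply: nxu; rewrite -def_w.
have [s1 [s2 def_s]] : exists s1 s2, x :: s = s1 ++ u :: s2.
  by case/splitPr: (all_s u) => s1 s2; exists s1, s2.
case: s2 def_s => [|y s2] def_s.
  move: zu; have -> : u = z by rewrite /z -(last_cons x) def_s last_cat.
  by rewrite adj_irrefl.
have uy : linked u y (x :: s) by apply/linkedP; exists s1, s2.
rewrite (linked_next Us uy) in xu.
have [a [def_a def_u]] : exists a, s = a ++ y :: s2 /\ last x a = u.
  case: (s1) def_s => [|x1 s1'] [-> ->]; first by exists [::].
  by exists (rcons s1' u); rewrite cat_rcons last_rcons.
have def_z : last y s2 = z by rewrite /z def_a last_cat.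
exists ((x :: a) ++ rev (y :: s2)), [set last x a; y].
rewrite def_a -cat_cons in Us all_s *.
have [||//|sub1 sub2] := cycle_edges_flip Us; rewrite ?def_u ?def_z //.
  by rewrite adj_sym.
rewrite def_z def_u in sub1 sub2; split=> //.
  by rewrite uniq_flip.
by move=> v; move: (all_s v); rewrite !mem_cat mem_rev.
Qed.

(** Induction on the bound [m] for the number of non-edges: each exchange removes one of them at the
    cost of at most one edge. *)
Lemma hamilton_cycle_from_order (G : sgraph) (m : nat) (q : seq G) :
  2 < #|G| -> (forall v : G, #|G| < 2 * degree v) ->
  uniq q -> (forall v, v \in q) -> #|cycle_edges q :\: edges G| <= m ->
  exists2 p, hamilton_cycle p &
    #|(cycle_edges q :&: edges G) :\: cycle_edges p| <= m.
Proof.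
move=> G3 deg; elim: m q => [|m IHm] q Uq all_q Bq.
  exists q; last by rewrite setDE setIAC -setDE setDv set0I cards0.
  split=> //.
    by rewrite -(card_uniqP Uq) (eq_card (B := G)) // => v; rewrite all_q.
  rewrite /ucycle Uq andbT; apply: cycle_from_next => // u u_in.
  rewrite -mem_edges; apply: contraLR Bq => e_bad; rewrite -ltnNge card_gt0.
  apply/set0Pn; exists [set u; next q u]; rewrite inE e_bad /=.
  by apply/imsetP; exists u.
have [good|bad] := boolP (cycle (@adj G) q).
  have [|p p_ham lost] := IHm q Uq all_q; last by exists p => //; apply: leqW.
  rewrite (_ : _ :\: _ = set0) ?cards0 //.
  apply/eqP; rewrite setD_eq0; apply/subsetP=> e /imsetP[u u_in ->].
  by rewrite mem_edges next_cycle.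
have [u u_in uv] : exists2 u, u \in q & ~~ adj u (next q u).
  apply/hasP; rewrite has_predC; apply: contra bad => /allP h.
  exact: cycle_from_next.
(* Rotating turns the bad pair into the wrap-around pair, which is the one that [two_opt]
   removes. *)
have [i [s def_s]] : exists i s, rot i q = next q u :: s.
  by have [i s] := rot_to (all_q (next q u)); exists i, s.
have Us : uniq (next q u :: s) by rewrite -def_s rot_uniq.
have def_u : last (next q u) s = u.
  apply: (can_inj (prev_next Uq)); rewrite -(next_rot i Uq) def_s.
  exact: next_last.
have all_s v : v \in next q u :: s by rewrite -def_s mem_rot.
have [|q' [e [Uq' all_q' sub1 sub2]]] := two_opt deg Us all_s.
  by rewrite def_u.
rewrite -def_s cycle_edges_rot // def_u in sub1 sub2.
have [|p p_ham lost] := IHm q' Uq' all_q'.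
  rewrite -ltnS (leq_trans _ Bq) // (leq_ltn_trans (subset_leq_card sub2)) //.
  rewrite [in X in _ < X](cardsD1 [set u; next q u]) inE mem_edges uv.
  by rewrite (imset_f (fun u => [set u; next q u])).
exists p => //.
apply: (leq_trans (n := #|e |: (cycle_edges q' :&: edges G :\: cycle_edges p)|)).
  apply: subset_leq_card; apply/subsetP=> f; rewrite !inE => /and3P[fp fq fG].
  have := subsetP sub1 f; rewrite !inE fq fG fp /= andbT => /(_ isT)/orP[->//|->].
  by rewrite orbT.
by rewrite cardsU1 -add1n leq_add // leq_b1.
Qed.

(** * Cutting a path cover and rejoining the pieces at their heads *)

Lemma linked_behead (T : eqType) (u v z : T) (s : seq T) :
  linked u v (z :: s) -> v \in s.
Proof.
case/linkedP=> -[|z' s1] [s2 [_ ->]]; first exact: mem_head.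
by rewrite mem_cat !inE eqxx !orbT.
Qed.

Lemma linked_prev (T : eqType) (u v : T) (s : seq T) :
  uniq s -> linked u v s -> prev s v = u.
Proof. by move=> Us /(linked_next Us) <-; rewrite prev_next. Qed.

Lemma linked_flatten (T : eqType) (u v : T) (b : seq T) (B : seq (seq T)) :
  b \in B -> linked u v b -> linked u v (flatten B).
Proof.
by case/splitPr=> B1 B2 uv; rewrite flatten_cat; apply/linked_catr/linked_catl.
Qed.

(** With [D] the path starts and the targets of a switch, the blocks are the paths left after
    deleting the edges that enter those targets. *)
Lemma cut_at (T : eqType) (D : pred T) (q : seq T) :
  exists s (L : seq (T * seq T)),
    [/\ q = s ++ flatten [seq p.1 :: p.2 | p <- L], all (predC D) s,
        [seq p.1 | p <- L] = filter D q &
        forall p, p \in L -> all (predC D) p.2].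
Proof.
elim: q => [|a q [s [L [def_q Ds heads_L DL]]]]; first by exists [::], [::].
case Da: (D a); last by exists (a :: s), L; rewrite /= Da Ds -def_q.
exists [::], ((a, s) :: L); split=> //=; first by rewrite -def_q.
  by rewrite Da heads_L.
by move=> p; rewrite inE => /predU1P[->|/DL].
Qed.

Lemma heads_subseq (T : eqType) (B : seq (seq T)) :
  subseq (pmap ohead B) (flatten B).
Proof.
elim: B => //= -[|x b] B IHB //=; rewrite eqxx.
exact: subseq_trans IHB (suffix_subseq _ _).
Qed.

Lemma linked_notin_heads (T : eqType) (u v : T) (b : seq T) (B : seq (seq T)) :
  uniq (flatten B) -> b \in B -> linked u v b -> v \notin pmap ohead B.
Proof.
elim: B => //= b0 B IHB; rewrite cat_uniq => /and3P[U0 /hasPn dis U].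
rewrite inE => /predU1P[->|bB] uv.
  have v_b0 : v \in b0 by case: (linked_mem uv).
  have v_B : v \notin pmap ohead B.
    by apply: contraL v_b0 => /(mem_subseq (heads_subseq B)) /dis.
  case: b0 {dis v_b0} => [|z s] //= in U0 uv *; rewrite inE negb_or v_B andbT.
  by apply: contraNneq (proj1 (andP U0)) => <-; apply: linked_behead uv.
have v_B : v \in flatten B.
  by apply/flattenP; exists b => //; case: (linked_mem uv).
case: b0 dis {U0} => [|z s] dis /=; rewrite ?inE ?negb_or IHB // andbT.
by apply: contraL v_B => /eqP->; apply/negP=> /dis; rewrite /= mem_head.
Qed.

Lemma linked_flattenE (T : eqType) (u v : T) (B : seq (seq T)) :
  linked u v (flatten B) -> v \notin pmap ohead B ->
  exists2 b, b \in B & linked u v b.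
Proof.
have head_flatten w s (B1 : seq (seq T)) :
    flatten B1 = w :: s -> w \in pmap ohead B1.
  by elim: B1 => [|[|z b] B1 IHB] //= [-> _]; rewrite mem_head.
elim: B => // b B IHB /= /linked_catE[uv|uv|[_ [s [_ /head_flatten v_in]]]].
- by exists b; rewrite ?mem_head.
- move=> vB; have [|b' b'B uv'] := IHB uv; last by exists b'; rewrite // inE b'B orbT.
  by case: b vB => //= z b; rewrite inE negb_or => /andP[].
- by case: b => /= [|z b]; rewrite ?inE v_in ?orbT.
Qed.

(** Unoriented, because joining two blocks reverses one of them. *)
Definition edge_in (T : eqType) (u v : T) (B : seq (seq T)) :=
  has (fun b => linked u v b || linked v u b) B.

(** Each pair merges two blocks, the first one reversed so that the two heads meet. All heads in
    [hs] are distinct, so later pairs find their own blocks untouched and no cycle can close. *)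
Lemma join_blocks (G : sgraph) (hs : seq (G * G)) (B : seq (seq G)) :
  uniq (unzip1 hs ++ unzip2 hs) ->
  (forall z, z \in unzip1 hs ++ unzip2 hs -> exists s, z :: s \in B) ->
  [::] \notin B -> (forall b u v, b \in B -> linked u v b -> adj u v) ->
  (forall p, p \in hs -> adj p.1 p.2) ->
  exists B',
    [/\ perm_eq (flatten B') (flatten B), size B = size B' + size hs,
        [::] \notin B', forall b u v, b \in B' -> linked u v b -> adj u v &
        (forall u v, edge_in u v B -> edge_in u v B') /\
        (forall p, p \in hs -> edge_in p.1 p.2 B')].
Proof.
elim: hs B => [|[x y] hs IHhs] B /= Uhs heads B0 adjB adjh.
  by exists B; rewrite addn0.
have [s xB] : exists s, x :: s \in B by apply: heads; rewrite mem_head.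
have [s' yB] : exists s, y :: s \in B.
  by apply: heads; rewrite inE mem_cat mem_head !orbT.
have xy_neq : x != y.
  by apply: contraTneq Uhs => ->; rewrite mem_cat mem_head orbT.
set B2 := rem (y :: s') (rem (x :: s) B).
have defB : perm_eq B [:: x :: s, y :: s' & B2].
  rewrite (permPl (perm_to_rem xB)) perm_cons perm_to_rem //.
  have : y :: s' \in (x :: s) :: rem (x :: s) B.
    by rewrite -(perm_mem (perm_to_rem xB)).
  by rewrite inE => /predU1P[[yx]|//]; rewrite yx eqxx in xy_neq.
set c := rev (x :: s) ++ y :: s'.
have memB b : b \in B = [|| b == x :: s, b == y :: s' | b \in B2].
  by rewrite (perm_mem defB) !inE.
have adj_xy : adj x y by apply: (adjh (x, y)); rewrite mem_head.
have [|||||B' [permB' sizeB' nilB' adjB' [inB' inhs]]] := IHhs (c :: B2).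
- move: Uhs => /andP[_]; rewrite cat_uniq /= => /and3P[U1 /norP[_ d] /andP[_ U2]].
  by rewrite cat_uniq U1 d.
- move=> z z_in.
  have [|t] := heads z.
    by move: z_in; rewrite inE !mem_cat inE => /orP[]->; rewrite !orbT.
  rewrite memB => /or3P[/eqP[zx _]|/eqP[zy _]|tB].
  + case/andP: Uhs => /negP[]; move: z_in; rewrite zx !mem_cat inE.
    by case/orP=> ->; rewrite ?orbT.
  + move: Uhs => /andP[_]; rewrite cat_uniq /= => /and3P[_ /norP[y1 _] /andP[y2 _]].
    by move: z_in; rewrite zy mem_cat (negPf y2) orbF => y1'; case/negP: y1.
  + by exists t; rewrite inE tB orbT.
- rewrite inE negb_or /c; apply/andP; split.
    by case: (rev (x :: s)).
  by apply: contra B0; rewrite memB => ->; rewrite !orbT.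
- move=> b u v; rewrite inE => /predU1P[->|bB2]; last first.
    by apply: adjB; rewrite memB bB2 !orbT.
  case/linked_catE=> [|uv|[a [b' [def_a [<- _]]]]].
  + by rewrite linked_rev adj_sym; apply: adjB.
  + exact: adjB uv.
  + by have := rev_cons x s; rewrite def_a => /rcons_inj[_ ->].
- by move=> p p_in; apply: adjh; rewrite inE p_in orbT.
have Hxy : edge_in x y B'.
  apply: inB'; apply/hasP; exists c; rewrite ?mem_head //.
  apply/orP; left; apply/linkedP; exists (rev s), s'.
  by rewrite /c rev_cons cat_rcons.
exists B'; split=> //.
- rewrite (permPl permB') (permPr (perm_flatten defB)) /= -!cat_cons catA.
  by rewrite perm_cat2r perm_cat2r perm_rev.
- by rewrite (perm_size defB) /= addnS -sizeB'.
split=> [u v /hasP[b]|p].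
  rewrite memB => /or3P[/eqP->|/eqP->|bB2] uv; apply: inB'; apply/hasP.
  + exists c; rewrite ?mem_head // orbC; apply/orP.
    by case/orP: uv => uv; [left|right]; apply: linked_catl; rewrite linked_rev.
  + exists c; rewrite ?mem_head //.
    by case/orP: uv => uv; apply/orP; [left|right]; apply: linked_catr.
  + by exists b; rewrite // inE bB2 orbT.
by rewrite inE => /predU1P[->|/inhs].
Qed.

(* The order [q] is a concatenation of paths of G, with [X] as the set of their
   starts. *)
Definition path_cover (G : sgraph) (q : seq G) (X : {set G}) :=
  [/\ uniq q, forall v, v \in q &
      forall v, v \notin X -> exists2 u, linked u v q & adj u v].

(** Cutting in front of the second endpoints in [hs] creates [size hs] additional blocks, and
    joining uses up equally many, so the number of starts is unchanged. Edges may be traversed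
    backwards in [q'], hence the equalities of unordered pairs. *)
Lemma path_cover_join (G : sgraph) (q : seq G) (X : {set G})
    (hs : seq (G * G)) :
  path_cover q X -> uniq (unzip1 hs ++ unzip2 hs) ->
  (forall p, p \in hs -> [/\ p.1 \in X, p.2 \notin X & adj p.1 p.2]) ->
  exists q' X',
    [/\ path_cover q' X', #|X'| = #|X|,
        forall u v, linked u v q -> v \notin X -> v \notin unzip2 hs ->
        exists u' v',
          [/\ linked u' v' q', v' \notin X' & [set u; v] = [set u'; v']] &
        forall p, p \in hs ->
        exists u' v',
          [/\ linked u' v' q', v' \notin X' & [set p.1; p.2] = [set u'; v']]].
Proof.
move=> [Uq all_q adj_q] Uhs hsX.
set D := [pred v | (v \in X) || (v \in unzip2 hs)].
have [s0 [L [def_q Ds0 heads_L DL]]] := cut_at D q.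
(* The first vertex of [q] has no predecessor, so it is a start and the first cut comes before
   it. *)
have s0_nil : s0 = [::].
  case: s0 Ds0 def_q => [|a s0] //= /andP[/norP[aX _] _] def_q.
  have [u ua _] := adj_q a aX; rewrite def_q in Uq ua.
  by move: Uq; rewrite cons_uniq (linked_behead ua).
rewrite {}s0_nil {s0 Ds0} /= in def_q; set B := map _ L in def_q.
have notD b u v : b \in B -> linked u v b -> ~~ D v.
  case/mapP=> -[z s] zsL -> /linked_behead vs.
  exact: (allP (DL _ zsL)).
have sub_q b u v : b \in B -> linked u v b -> linked u v q.
  by rewrite def_q; apply: linked_flatten.
have [||||B' [permB' sizeB' nilB' adjB' [inB' inhs]]] := @join_blocks G hs B Uhs.
- move=> z z_in; have : z \in [seq p.1 | p <- L].
    rewrite heads_L mem_filter all_q andbT /= orbC; move: z_in; rewrite mem_cat.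
    by case/orP=> [/mapP[p /hsX[pX _ _] ->]|->//]; rewrite pX orbT.
  by case/mapP=> -[z' s] zL ->; exists s; apply/mapP; exists (z', s).
- by apply/mapP=> -[].
- move=> b u v bB uv; have /norP[vX _] := notD _ _ _ bB uv.
  have [u' u'v] := adj_q v vX; have uv_q := sub_q _ _ _ bB uv.
  by rewrite -(linked_prev Uq u'v) (linked_prev Uq uv_q).
- by move=> p /hsX[].
have Uq' : uniq (flatten B') by rewrite (perm_uniq permB') -def_q.
pose X' := [set v in pmap ohead B'].
have linkedX' u v b : b \in B' -> linked u v b -> v \notin X'.
  by move=> bB' uv; rewrite inE; apply: linked_notin_heads Uq' bB' uv.
have edge_q' u v : edge_in u v B' ->
    exists u' v',
      [/\ linked u' v' (flatten B'), v' \notin X' &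
          [set u; v] = [set u'; v']].
  case/hasP=> b bB' /orP[] uv.
    by exists u, v; rewrite (linkedX' _ _ _ bB' uv) (linked_flatten bB' uv).
  by exists v, u; rewrite setUC (linkedX' _ _ _ bB' uv) (linked_flatten bB' uv).
exists (flatten B'), X'; split.
- split=> //; first by move=> v; rewrite (perm_mem permB') -def_q.
  move=> v vX'; have : v \in flatten B' by rewrite (perm_mem permB') -def_q.
  case/flattenP=> b bB' /[dup] vb /splitPr def_b.
  have [s1 [s2 {}def_b]] : exists s1 s2, b = s1 ++ v :: s2.
    by case: def_b => s1 s2; exists s1, s2.
  case/lastP: s1 def_b => [|s1 u] def_b.
    by case/negP: vX'; rewrite inE mem_pmap; apply/mapP; exists b => //; rewrite def_b.
  have uv : linked u v b by apply/linkedP; exists s1, s2; rewrite def_b cat_rcons.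
  by exists u; [apply: linked_flatten uv|apply: adjB' uv].
- rewrite cardsE (card_uniqP _); last exact: subseq_uniq (heads_subseq B') Uq'.
  rewrite size_pmap; apply/eqP; rewrite -(eqn_add2r (size hs)); apply/eqP.
  transitivity (size B).
    rewrite sizeB'; congr addn; apply/eqP; rewrite -all_count.
    by apply/allP=> -[|//] nil_in; rewrite nil_in in nilB'.
  rewrite size_map -(size_map fst) heads_L -(size_map snd hs) cardE -size_cat.
  apply/eqP; rewrite -uniq_size_uniq ?filter_uniq //.
    rewrite cat_uniq enum_uniq; move: Uhs; rewrite cat_uniq => /and3P[_ _ ->].
    rewrite andbT; apply/hasPn=> _ /mapP[p /hsX[_ pX _] ->].
    by rewrite /= mem_enum.
  by move=> v; rewrite mem_cat mem_enum mem_filter all_q andbT.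
- move=> u v uv vX vhs; apply: edge_q'; apply: inB'.
  rewrite def_q in uv; have [|b bB uv'] := linked_flattenE uv.
    rewrite /B mem_pmap -map_comp (eq_map (g := Some \o fst)) //.
    rewrite map_comp mem_map; last by move=> ? ? [].
    by rewrite heads_L mem_filter /= negb_and negb_or vX vhs.
  by apply/hasP; exists b; rewrite // uv'.
- by move=> p /inhs /edge_q'.
Qed.

(** * Switches and the colours they gain or free *)

Lemma leq_size_undup (T : eqType) (s1 s2 : seq T) :
  {subset s1 <= s2} -> size (undup s1) <= size (undup s2).
Proof.
move=> sub; apply: uniq_leq_size (undup_uniq s1) _ => x.
by rewrite !mem_undup; apply: sub.
Qed.

Lemma proper_star_inj (G : sgraph) (C : eqType) (chi : {set G} -> C) (x : G) :
  proper_edge_colouring chi ->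
  {in [pred y | adj x y] &, injective (fun y => chi [set x; y])}.
Proof.
move=> chiP y y'; rewrite !inE => xy xy' E; apply/eqP/negPn/negP=> yy'.
have /negP[] : chi [set x; y] != chi [set x; y']; last by rewrite E.
apply: chiP; rewrite ?mem_edges //; last first.
  by apply/set0Pn; exists x; rewrite !inE eqxx.
apply: contraNneq yy' => /setP/(_ y); rewrite !inE eqxx orbT.
by case/esym/orP=> // /eqP yx; rewrite yx adj_irrefl in xy.
Qed.

(** The condition on the pairs [x_i y_i] under which [path_cover_join] can carry out the switch. *)
Definition switch_list (G : sgraph) (X : {set G}) (hs : seq (G * G)) :=
  uniq (unzip1 hs ++ unzip2 hs) /\
  forall p, p \in hs -> [/\ p.1 \in X, p.2 \notin X & adj p.1 p.2].

(* The colours left after adding the edges [hs] and deleting the edges entering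
   their second endpoints; [f v] is the colour of the edge entering [v]. *)
Definition switch_colours (G : sgraph) (C : eqType) (chi : {set G} -> C)
    (f : G -> C) (T : {set G}) (hs : seq (G * G)) : seq C :=
  [seq f v | v <- enum T & v \notin unzip2 hs] ++
  [seq chi [set p.1; p.2] | p <- hs].

(* For [y] in [Y] some switch makes the edge entering [y] redundant, so that its
   colour becomes available to the next start. *)
Lemma switch_growth (G : sgraph) (C : eqType) (chi : {set G} -> C) (f : G -> C)
    (X T : {set G}) (d : nat) (s : seq G) :
  proper_edge_colouring chi -> (forall v : G, d <= degree v) ->
  {in T &, injective f} -> uniq s -> {subset s <= X} ->
  (exists2 hs, switch_list X hs &
     #|T| < size (undup (switch_colours chi f T hs))) \/
  exists Y : {set G},
    [/\ Y \subset T, size s * (d - #|T| - #|X|) <= #|Y| &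
    forall y, y \in Y -> exists hs,
      [/\ switch_list X hs, {subset unzip1 hs <= s}, {subset unzip2 hs <= Y} &
          #|T| < size (undup (f y :: switch_colours chi f T hs))]].
Proof.
move=> chiP deg injf; elim: s => [|x s IHs] /=.
  by move=> _ _; right; exists set0; rewrite sub0set; split=> // y; rewrite inE.
move=> /andP[x_s Us] sX; have xX : x \in X by apply: sX; rewrite mem_head.
have [||imp|[Y [YT cardY growY]]] := IHs; [by []| |by left|].
  by move=> v vs; apply: sX; rewrite inE vs orbT.
(* [W] collects the neighbours whose edge to [x] has a colour still blocked by [T :\: Y]. The
   colours at [x] are distinct, so [W] shrinks as [Y] grows; [Z] is the set of usable targets. *)
pose W := [set y | adj x y & chi [set x; y] \in [seq f v | v in T :\: Y]].
pose Z := [set y | [&& adj x y, y \notin X & y \notin W]].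
have cardW : #|W| <= #|T| - #|Y|.
  have -> : #|T| - #|Y| = #|T :\: Y| by rewrite cardsD (setIidPr YT).
  have -> : #|W| = size [seq chi [set x; y] | y in W] by rewrite size_image.
  rewrite -(size_image f (T :\: Y)); apply: uniq_leq_size.
    rewrite map_inj_in_uniq ?enum_uniq // => y y'.
    rewrite !mem_enum !inE => /andP[xy _] /andP[xy' _].
    exact: proper_star_inj chiP _ _ xy xy'.
  by move=> c /mapP[y]; rewrite mem_enum inE => /andP[_ chi_y] ->.
have cardZ : d <= #|Z| + #|X| + #|W|.
  apply: leq_trans (deg x) _; apply: leq_trans (_ : #|Z :|: X :|: W| <= _).
    apply: subset_leq_card; apply/subsetP=> y; rewrite !inE => xy.
    by rewrite xy /=; do 2!case: (_ \in _).
  apply: leq_trans (leq_card_setU _ _) _; rewrite leq_add2r.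
  exact: leq_card_setU.
have extend y : y \in Z -> y \notin Y -> exists hs,
    [/\ switch_list X ((x, y) :: hs), {subset unzip1 hs <= s},
        {subset unzip2 hs <= Y} &
        #|T| < size (undup (chi [set x; y] :: switch_colours chi f T hs))].
  rewrite inE => /and3P[xy yX yW] yY.
  suff [hs [[Uhs hsX] hs1 hs2 lt_hs]] : exists hs,
    [/\ switch_list X hs, {subset unzip1 hs <= s},
        {subset unzip2 hs <= Y} &
        #|T| < size (undup (chi [set x; y] :: switch_colours chi f T hs))].
    exists hs; split=> //; split.
      have y2 : y \notin unzip2 hs by apply: contra yY; apply: hs2.
      have y1 : y \notin unzip1 hs.
        by apply: contra yX => /hs1 ys; apply: sX; rewrite inE ys orbT.
      have x1 : x \notin unzip1 hs by apply: contra x_s; apply: hs1.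
      have x2 : x \notin unzip2 hs.
        by apply: contraL xX => /mapP[p /hsX[_ + _] ->].
      have xy_neq : x != y by apply: contraNneq yX => <-.
      move: Uhs; rewrite /= mem_cat inE !negb_or x1 x2 xy_neq /= !cat_uniq /=.
      by case/and3P=> -> h ->; rewrite y2 negb_or y1 h.
    by move=> p; rewrite inE => /predU1P[->|/hsX].
  (* Either the colour of the new edge belongs to some [v] in [Y], and the switch that makes [f v]
     redundant serves; or, as [y] is not in [W], it is missing from all of [T] and the empty switch
     serves. *)
  have [/imageP[v vY ->]|notY] := boolP (chi [set x; y] \in [seq f v | v in Y]).
    exact: growY.
  exists [::]; split=> //; rewrite /switch_colours /= cats0.
  have notT : chi [set x; y] \notin [seq f v | v in T].
    apply: contra yW => /imageP[v vT def_v]; rewrite inE xy def_v /=.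
    apply: image_f; rewrite inE vT andbT.
    by apply: contra notY => vY; rewrite def_v; apply: image_f.
  rewrite (eq_filter (a2 := predT)) // filter_predT (negPf notT) /=.
  rewrite undup_id ?size_map -?cardE // map_inj_in_uniq ?enum_uniq // => v v'.
  by rewrite !mem_enum; apply: injf.
(* For [y] outside [T] the edge deleted at [y] carries no counted colour, so adding [x y] is a net
   gain. *)
have [ZT|] := boolP (Z \subset T); last first.
  case/subsetPn=> y yZ yT; left.
  have [|hs [hsP _ _ lt_hs]] := extend y yZ; first
    by apply: contra yT; apply: (subsetP YT).
  exists ((x, y) :: hs) => //; apply: leq_trans lt_hs _; apply: leq_size_undup.
  move=> c; rewrite inE !mem_cat inE => /predU1P[->|/orP[|->]]; rewrite ?eqxx ?orbT //.
  case/mapP=> v; rewrite mem_filter mem_enum => /andP[v2 vT] ->.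
  apply/orP; left; apply: map_f; rewrite mem_filter mem_enum vT inE negb_or v2.
  by rewrite /= !andbT; apply: contraNneq yT => <-.
right; exists (Y :|: Z); split; first by rewrite subUset YT.
  (* If the truncated difference vanishes, the bound is trivial. Otherwise [Z] alone suffices: it
     has at least [d - #|T| - #|X| + #|Y|] elements. *)
  have [le_d|] := leqP (d - #|T| - #|X|) 0; first by lia.
  have := subset_leq_card (subsetUr Y Z); have := subset_leq_card YT.
  move: cardW cardZ cardY; rewrite mulSn; lia.
move=> y; rewrite inE; have [yY _|yY /= yZ] := boolP (y \in Y).
  have [hs [hsP hs1 hs2 lt_hs]] := growY y yY; exists hs; split=> //.
    by move=> v /hs1 vs; rewrite inE vs orbT.
  by move=> v /hs2 vY; rewrite inE vY.
(* Adding [x y] costs at most the colour [f y], which the list on the right restores. *)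
have [hs [hsP hs1 hs2 lt_hs]] := extend y yZ yY; exists ((x, y) :: hs); split=> //.
- by move=> v; rewrite !inE => /predU1P[->|/hs1 ->]; rewrite ?eqxx ?orbT.
- by move=> v /predU1P[->|/hs2 vY]; rewrite in_setU ?yZ ?vY ?orbT.
apply: leq_trans lt_hs (leq_size_undup (s2 := f y :: switch_colours _ _ _ _) _).
move=> c; rewrite !inE !mem_cat inE => /predU1P[->|/orP[|->]]; rewrite ?eqxx ?orbT //.
case/mapP=> v; rewrite mem_filter mem_enum => /andP[v2 vT] ->.
have [->|vy] := eqVneq v y; first by rewrite eqxx.
apply/orP; right; apply/orP; left.
by apply: map_f; rewrite mem_filter mem_enum vT inE negb_or vy v2.
Qed.

(** Supplies the new set [T] after a switch: one vertex for each colour obtained. *)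
Lemma exists_representatives (T : finType) (C : eqType) (g : T -> C)
    (A : {set T}) (s : seq C) :
  uniq s -> (forall c, c \in s -> exists2 v, v \in A & g v = c) ->
  exists A' : {set T}, [/\ A' \subset A, {in A' &, injective g},
    forall v, v \in A' -> g v \in s & #|A'| = size s].
Proof.
elim: s => [|c s IHs] /= => [_ _|/andP[c_s Us] sA].
  by exists set0; rewrite sub0set cards0; split=> // v; rewrite inE.
have [||A' [A'A injA' sA' cardA']] := IHs; first by [].
  by move=> c' c's; apply: sA; rewrite inE c's orbT.
have [v vA def_c] := sA c (mem_head c s).
have vA' w : w \in A' -> g v <> g w.
  by move=> /sA' ws E; rewrite -def_c E ws in c_s.
exists (v |: A'); split.
- by rewrite subUset sub1set vA.
- move=> u w; rewrite !inE => /predU1P[->|uA] /predU1P[->|wA] // E.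
  + by case: (vA' w wA).
  + by case: (vA' u uA).
  exact: injA'.
- by move=> w; rewrite !inE => /predU1P[->|/sA' ->]; rewrite ?def_c ?eqxx ?orbT.
rewrite cardsU1 cardA'; case: (boolP (v \in A')) => // vIn.
by case: (vA' v vIn).
Qed.

(** * Enlarging the rainbow set of a path cover *)

Definition in_edge (G : sgraph) (q : seq G) (v : G) : {set G} :=
  [set prev q v; v].

(** [T] avoids the starts because [in_edge q v] need not be an edge when [v] is a start; at the
    first entry of [q], [prev] wraps around. *)
Definition rainbow_cover (G : sgraph) (C : eqType) (chi : {set G} -> C)
    (q : seq G) (X T : {set G}) :=
  [/\ path_cover q X, T \subset ~: X & {in T &, injective (chi \o in_edge q)}].

(** With all of [X] processed, the second outcome of [switch_growth] would give a subset of [T]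
    larger than [T]; hence some switch gains a colour. *)
Lemma rainbow_cover_improve (G : sgraph) (C : eqType) (chi : {set G} -> C)
    (q : seq G) (X T : {set G}) (d : nat) :
  proper_edge_colouring chi -> (forall v : G, d <= degree v) ->
  rainbow_cover chi q X T -> #|T| < #|X| * (d - #|T| - #|X|) ->
  exists q' X' T',
    [/\ rainbow_cover chi q' X' T', #|X'| = #|X| & #|T| < #|T'|].
Proof.
move=> chiP deg [coverX TX injT] small_T.
have subX : {subset enum X <= X} by move=> v; rewrite mem_enum.
case: (switch_growth chiP deg injT (enum_uniq X) subX) => [[hs [Uhs hsX] lt_hs]|].
- have [Uq all_q adj_q] := coverX.
  have [q' [X' [coverX' cardX' keep new]]] := path_cover_join coverX Uhs hsX.
  have [Uq' _ _] := coverX'.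
  have [|T' [T'X' injT' _ cardT']] := @exists_representatives _ _
    (chi \o in_edge q') (~: X') _
    (undup_uniq (switch_colours chi (chi \o in_edge q) T hs)).
    move=> c; rewrite mem_undup mem_cat.
    have new_rep e :
        (exists u v, [/\ linked u v q', v \notin X' & e = [set u; v]]) ->
        exists2 v, v \in ~: X' & (chi \o in_edge q') v = chi e.
      case=> u [v [uv vX' ->]]; exists v; rewrite ?inE //=.
      by rewrite /in_edge (linked_prev Uq' uv).
    case/orP=> /mapP[]; last by move=> p /new p_new ->; apply: new_rep.
    move=> v; rewrite mem_filter mem_enum => /andP[v_hs vT] -> /=; apply: new_rep.
    have vX : v \notin X by move: (subsetP TX v vT); rewrite inE.
    have [u uv _] := adj_q v vX.
    by rewrite /in_edge (linked_prev Uq uv); apply: keep.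
  by exists q', X', T'; rewrite cardT'.
- case=> Y [YT + _]; rewrite -cardE leqNgt => /negP[].
  exact: leq_ltn_trans (subset_leq_card YT) small_T.
Qed.

(** Improvement starts from the empty [T] and must stop, as [#|T|] increases but is at most
    [#|G|]. *)
Lemma exists_rainbow_cover (G : sgraph) (C : eqType) (chi : {set G} -> C)
    (q : seq G) (X : {set G}) (d : nat) :
  proper_edge_colouring chi -> (forall v : G, d <= degree v) ->
  path_cover q X ->
  exists q' X' T', [/\ rainbow_cover chi q' X' T', #|X'| = #|X| &
    #|X| * (d - #|T'| - #|X|) <= #|T'|].
Proof.
move=> chiP deg coverX.
suff improve m q0 X0 T0 : rainbow_cover chi q0 X0 T0 -> #|X0| = #|X| ->
    #|G| - #|T0| <= m ->
    exists q' X' T', [/\ rainbow_cover chi q' X' T', #|X'| = #|X| &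
      #|X| * (d - #|T'| - #|X|) <= #|T'|].
  apply: (improve _ q X set0) => //; split=> //; first exact: sub0set.
  by move=> v w; rewrite inE.
elim: m q0 X0 T0 => [|m IHm] q0 X0 T0 coverT cardX0 le_m;
  have [le_T|small_T] := leqP (#|X0| * (d - #|T0| - #|X0|)) #|T0|;
  try by exists q0, X0, T0; rewrite -cardX0.
all: have [q1 [X1 [T1 [coverT1 cardX1 lt_T]]]] :=
  rainbow_cover_improve chiP deg coverT small_T.
  by have := max_card T1; lia.
by apply: (IHm q1 X1 T1) => //; [rewrite cardX1|have := max_card T1; lia].
Qed.

(** * From covers to Hamilton cycles with many colours *)

(** The first [t] vertices serve as starts: [t - 1] single vertices and one long path. Only the
    number of paths matters later. *)
Lemma hamilton_cycle_path_cover (G : sgraph) (p : seq G) (t : nat) :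
  hamilton_cycle p -> 0 < t <= #|G| ->
  exists2 X : {set G}, path_cover p X & #|X| = t.
Proof.
case=> _ /andP[p_cycle Up] all_p /andP[t_gt0 t_le].
exists [set v in take t p]; last first.
  rewrite cardsE (card_uniqP _) ?take_uniq // size_take_min; apply/minn_idPl.
  by rewrite -(card_uniqP Up) (eq_card (B := G)) // => v; rewrite all_p.
split=> // v; rewrite inE => v_take.
have [s1 [s2 def_p]] : exists s1 s2, p = s1 ++ v :: s2.
  by case/splitPr: (all_p v) => s1 s2; exists s1, s2.
case/lastP: s1 def_p => [|s1 u] def_p.
  by case: t t_gt0 {t_le} v_take => // t _; rewrite def_p mem_head.
have uv : linked u v p by apply/linkedP; exists s1, s2; rewrite def_p cat_rcons.
by exists u; rewrite // -(linked_next Up uv) next_cycle.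
Qed.

(** Every non-edge of the cyclic order enters a start, so closing up costs at most [#|X|] edges and
    thus at most [#|X|] of the colours of [T]. *)
Lemma rainbow_cover_hamilton (G : sgraph) (C : eqType) (chi : {set G} -> C)
    (q : seq G) (X T : {set G}) :
  2 < #|G| -> (forall v : G, #|G| < 2 * degree v) -> rainbow_cover chi q X T ->
  exists2 p, hamilton_cycle p &
    #|T| <= num_colours chi (cycle_edges p) + #|X|.
Proof.
move=> G3 deg [[Uq all_q adj_q] TX injT].
have next_in_edge v : in_edge q v \in cycle_edges q.
  by apply/imsetP; exists (prev q v); rewrite ?all_q ?next_prev.
have in_edge_adj v : v \notin X -> in_edge q v \in edges G.
  by case/adj_q=> u uv; rewrite /in_edge (linked_prev Uq uv) mem_edges.
have [|p p_ham lost] := hamilton_cycle_from_order (m := #|X|) G3 deg Uq all_q.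
  apply: leq_trans (leq_imset_card (in_edge q) X); apply: subset_leq_card.
  apply/subsetP=> e; rewrite inE => /andP[e_bad /imsetP[u _ def_e]].
  have e_in : e = in_edge q (next q u) by rewrite /in_edge prev_next.
  apply/imsetP; exists (next q u) => //; apply: contraNT e_bad => /in_edge_adj.
  by rewrite -e_in.
exists p => //; pose T1 := [set v in T | in_edge q v \in cycle_edges p].
rewrite -(cardsID T1 T) leq_add //.
  have -> : #|T :&: T1| = size [seq (chi \o in_edge q) v | v in T :&: T1].
    by rewrite size_image.
  apply: uniq_leq_size.
    rewrite map_inj_in_uniq ?enum_uniq // => v w.
    by rewrite !mem_enum => /setIP[vT _] /setIP[wT _]; apply: injT.
  move=> _ /mapP[v + ->]; rewrite mem_enum !inE => /and3P[_ _ vp].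
  by rewrite mem_undup /= map_f ?mem_enum.
apply: leq_trans lost; rewrite -(card_in_imset (f := in_edge q)); last first.
  move=> v w /setDP[vT _] /setDP[wT _] E; apply: injT => //=.
  by rewrite /= E.
apply: subset_leq_card; apply/subsetP=> _ /imsetP[v + ->].
rewrite !inE next_in_edge => /andP[+ vT]; rewrite vT /= => -> /=.
by rewrite in_edge_adj //; move: (subsetP TX v vT); rewrite inE.
Qed.

Lemma hamilton_cycle_many_colours (G : sgraph) (C : eqType)
    (chi : {set G} -> C) (d t : nat) :
  proper_edge_colouring chi -> 2 < #|G| -> (forall v : G, d <= degree v) ->
  #|G| < 2 * d -> t <= #|G| < t * t ->
  exists2 p, hamilton_cycle p & d <= num_colours chi (cycle_edges p) + 3 * t.
Proof.
move=> chiP G3 deg dirac /andP[t_le t_gt].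
have dirac_deg (v : G) : #|G| < 2 * degree v.
  by apply: leq_trans dirac _; rewrite leq_mul2l deg.
have all_enum v : v \in enum G by rewrite mem_enum.
(* Dirac's theorem: an arbitrary enumeration is closed up, with no concern for the edges lost. *)
have [q0 q0_ham _] :=
  hamilton_cycle_from_order G3 dirac_deg (enum_uniq G) all_enum (leqnn _).
have t_gt0 : 0 < t by case: t t_gt {t_le}.
have [|X coverX cardX] := hamilton_cycle_path_cover (t := t) q0_ham.
  by rewrite t_gt0.
have [q [X' [T [coverT cardX' cardT]]]] := exists_rainbow_cover chiP deg coverX.
rewrite cardX in cardX' cardT.
have [p p_ham colours] := rainbow_cover_hamilton G3 dirac_deg coverT.
exists p => //; rewrite cardX' in colours.
(* Dividing by [t] gives [d < #|T| + 2 * t]; closing up costs another [t]. *)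
have : t * (d - #|T| - t) < t * t.
  exact: leq_ltn_trans cardT (leq_ltn_trans (max_card _) t_gt).
by rewrite ltn_pmul2l //; lia.
Qed.

Lemma min_degree_le (G : sgraph) (v : G) : min_degree G <= degree v.
Proof.
rewrite /min_degree; have := mem_index_enum v.
elim: (index_enum G) => // w s IHs; rewrite inE big_cons.
by move=> /predU1P[<-|/IHs]; [exact: geq_minl|apply: leq_trans (geq_minr _ _)].
Qed.

Local Open Scope ring_scope.

Theorem theorem1p3 (R : realType) (c : R) (hc : 1 / 2 < c) (hc1 : c <= 1) :
  exists (K : R) (n0 : nat), 0 < K /\
    forall n : nat, (n0 <= n)%N ->
    forall G : sgraph, #|G| = n ->
    c * n%:R <= (min_degree G)%:R ->
    forall (C : eqType) (chi : {set G} -> C),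
    proper_edge_colouring chi ->
    exists p : seq G, hamilton_cycle p /\
      c * n%:R - K * Num.sqrt n%:R <= (num_colours chi (cycle_edges p))%:R.
Proof.
(* The loss is [3 * t] with [t <= sqrt n + 1 <= 2 * sqrt n], hence 6; a Hamilton cycle needs three
   vertices. *)
exists 6, 3%N; split=> // n n3 G cardG degG C chi chiP.
have [t t_gt t_min] :
    {t | (n < t * t)%N & forall m, (n < m * m)%N -> (t <= m)%N}.
  have ex_t : exists m, (n < m * m)%N by exists n.+1; nia.
  by exists (ex_minn ex_t); case: ex_minnP.
have t_gt0 : (0 < t)%N by case: t t_gt {t_min}.
have t_pred : (t.-1 * t.-1 <= n)%N.
  by rewrite leqNgt; apply/negP=> /t_min; rewrite leqNgt prednK // leqnn.
have sqrt_ge1 : 1 <= Num.sqrt n%:R :> R.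
  by rewrite -[leLHS]sqrtr1 ler_wsqrtr // ler1n (leq_trans _ n3).
have t_le : t%:R <= Num.sqrt n%:R + 1 :> R.
  rewrite -(prednK t_gt0) -natr1 lerD2r -[leLHS]ger0_norm // -sqrtr_sqr.
  by rewrite ler_wsqrtr // -natrX ler_nat expnS expn1.
have n_gt0 : 0 < n%:R :> R by rewrite ltr0n (leq_trans _ n3).
have [||||p p_ham colours] :=
  @hamilton_cycle_many_colours G C chi (min_degree G) t chiP.
- by rewrite cardG.
- exact: min_degree_le.
(* The assumption [1 / 2 < c] enters here, as Dirac's condition. *)
- rewrite cardG -(ltr_nat R) natrM.
  apply: lt_le_trans (_ : 2 * (c * n%:R) <= _); last by rewrite ler_pM2l.
  by rewrite mulrA -[ltLHS]mul1r ltr_pM2r //; lra.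
- by rewrite cardG t_gt andbT; nia.
exists p; split=> //.
have : (min_degree G)%:R <= (num_colours chi (cycle_edges p))%:R + 3 * t%:R :> R.
  by rewrite -natrM -natrD ler_nat.
lra.
Qed.
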